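(* Let $\mathcal{T}=(V,E)$ be a countably infinite rooted and leafless directed tree, $\boldsymbol{\beta}=\{\beta_v\}_{v\in V}\subseteq(0,\infty)$ and $\boldsymbol{\lambda}=\{\lambda_v\}_{v\in V^\circ}\subseteq(0,\infty)$. Let the weighted shift $S_{\boldsymbol{\lambda}}$ on $\mathcal{T}_{\boldsymbol{\beta}}$ be bounded on $\ell^2(\boldsymbol{\beta})$. Then $$\{z\in\mathbb{C}:|z|<r_2^+(S_{\boldsymbol\lambda})\}\subseteq\sigma_p(S_{\boldsymbol\lambda}^* ).$$
   Context: $\mathbb{N}_0=\{0,1,2,\dots\}$; $\sigma_p(A)$ is the point spectrum of $A$. A rooted directed tree $\mathcal{T}=(V,E)$ is a connected directed graph without circuits having a unique vertex $\mathrm{root}$ without a parent and such that every $v\in V^\circ:=V\setminus\{\mathrm{root}\}$ has a unique parent $\mathrm{par}(v)$, i.e. a unique $u$ with $(u,v)\in E$. $\mathrm{par}^k$ is the $k$-fold composition of $\mathrm{par}$ ($\mathrm{par}^0$ the identity); $\mathrm{Chi}(u)=\{v\in V:(u,v)\in E\}$; leafless means every vertex has at least one child; $|v|$ is the unique $k\in\mathbb{N}_0$ with $\mathrm{par}^k(v)=\mathrm{root}$. Put $\lambda_{\mathrm{root}|v}=\prod_{j=0}^{|v|-1}\lambda_{\mathrm{par}^j(v)}$ (equal to $1$ if $v=\mathrm{root}$). $\ell^2(\boldsymbol{\beta})$ is the Hilbert space of all $f:V\to\mathbb{C}$ with $\|f\|_{\boldsymbol\beta}^2=\sum_{v\in V}|f(v)|^2\beta_v<\infty$,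 with $\langle f,g\rangle_{\boldsymbol\beta}=\sum_{v\in V} f(v)\overline{g(v)}\beta_v$. $\mathcal{T}_{\boldsymbol\beta}$ denotes the pair $(\mathcal{T},\boldsymbol\beta)$. The weighted shift $S_{\boldsymbol{\lambda}}$ on $\mathcal{T}_{\boldsymbol\beta}$ is given by $(S_{\boldsymbol\lambda}f)(v)=\lambda_v f(\mathrm{par}(v))$ for $v\in V^\circ$, $(S_{\boldsymbol\lambda}f)(\mathrm{root})=0$, on the domain of all $f\in\ell^2(\boldsymbol\beta)$ for which the resulting function lies in $\ell^2(\boldsymbol\beta)$; the adjoint is taken with respect to $\langle\cdot,\cdot\rangle_{\boldsymbol\beta}$. A path in $\mathcal{T}$ is a subgraph $\mathscr{P}$ of $\mathcal{T}$ which is itself a directed tree, contains $\mathrm{root}$, and in which every vertex has exactly one child (with respect to $\mathscr{P}$). $\mathscr{P}(\mathcal{T})$ denotes the collection of all paths in $\mathcal{T}$. For a path $\mathscr{P}$ put $$r_2^{\mathscr{P}}(S_{\boldsymbol\lambda})=\lim_{n\to\infty}\inf\Big\{\big(\sqrt{\beta_v}\,\lambda_{\mathrm{root}|v}\big)^{1/|v|}: v\in\mathscr{P},\ |v|\ge n\Big\},$$ and $r_2^+(S_{\boldsymbol\lambda})=\sup\{r_2^{\mathscr{P}}(S_{\boldsymbol\lambda}):\mathscr{P}\in\mathscr{P}(\mathcal{T})\}$. *)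

(* Defs.v *)
From mathcomp Require Import all_boot all_order all_algebra finmap.
From mathcomp Require Import all_classical all_reals all_analysis complex.
From mathcomp.analysis.showcase Require summability.
Set Implicit Arguments.
Unset Strict Implicit.
Unset Printing Implicit Defensive.
Import Order.TTheory GRing.Theory Num.Theory.
Import numFieldNormedType.Exports.
Local Open Scope classical_set_scope.
Local Open Scope ring_scope.

Section directed_trees.
Variable V : choiceType.
Implicit Types (W : set V) (E F : rel V) (u v rt : V).

Definition digraph W E := forall u v, E u v -> W u /\ W v.

Definition connected_digraph W E :=
  forall u v, W u -> W v ->
    exists2 p, path [rel x y | E x y || E y x] u p & last u p = v.

(* A circuit is a nonempty cyclic sequence of distinct vertices whose
   consecutive vertices are joined by edges; [c := [:: v]] is a loop at [v]. *)
Definition no_circuit E := ~ exists2 c : seq V, c != [::] & ucycle E c.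

Definition parentless W E : set V := [set v | W v /\ forall u, ~~ E u v].

(* A directed tree may be rootless; a vertex without a parent is exempted from
   the unique-parent condition. *)
Definition directed_tree W E :=
  [/\ digraph W E, connected_digraph W E, no_circuit E &
      forall v, W v -> ~ parentless W E v -> exists! u, E u v].

Definition rooted_directed_tree W E rt :=
  directed_tree W E /\ parentless W E = [set rt].

Definition Chi E u : set V := [set v | E u v].

Definition leafless W E := forall u, W u -> Chi E u !=set0.

(* A path of the tree [([set: V], E)] with root [rt], given by its vertex set
   [W] and its edge relation [F]. *)
Definition tree_path E rt W F :=
  [/\ forall u v, F u v -> E u v,
      directed_tree W F,
      W rt &
      forall u, W u -> exists! v, F u v].

(* Total version of the parent map: [par E v = v] if [v] has no parent. *)
Definition par E v : V := xget v [set u | E u v].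

(* As [par E rt = rt], the iterates of [par] are constantly [rt] from some
   point on; the number of genuine parents to be taken is the first time at
   which [rt] is reached. *)
Definition depth E rt v : nat :=
  xget 0%N [set k | iter k (par E) v = rt /\
                    forall j, (j < k)%N -> iter j (par E) v <> rt].

End directed_trees.

Section weighted_l2.
Variables (R : realType) (V : choiceType) (beta : V -> R).
Implicit Types f g : V -> R[i].

Definition sqnorm_l2 f : \bar R :=
  (\esum_(v in [set: V]) (Normc.normc (f v) ^+ 2 * beta v)%:E)%E.

Definition l2 : set (V -> R[i]) := [set f | (sqnorm_l2 f < +oo)%E].

Definition norm_l2 f : R := Num.sqrt (fine (sqnorm_l2 f)).

(* [summability.sum] is the unconditional sum over [V], i.e. the limit of the
   finite partial sums along the directed set of finite subsets of [V]; it
   converges for [f] and [g] in [l2], by Cauchy-Schwarz. *)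
Definition inner_l2 f g : R[i] :=
  summability.sum (fun v => (f v * (g v)^*%C * (beta v)%:C%C : R[i]^o)).

(* Operators in [l2] are represented by their graphs. *)
Definition operator := set ((V -> R[i]) * (V -> R[i])).

Definition dom (A : operator) : set (V -> R[i]) := [set f | exists g, A (f, g)].

Definition bounded_on_l2 (A : operator) :=
  dom A = l2 /\
  exists M : R, forall f g, A (f, g) -> norm_l2 g <= M * norm_l2 f.

Definition adjoint (A : operator) : operator :=
  [set fg | [/\ l2 fg.1, l2 fg.2 &
    forall h k, A (h, k) -> inner_l2 k fg.1 = inner_l2 h fg.2]].

Definition point_spectrum (A : operator) : set R[i] :=
  [set z | exists f, f <> (fun=> 0) /\ A (f, fun v => z * f v)].

End weighted_l2.

Section weighted_shift.
Variables (R : realType) (V : choiceType) (E : rel V) (rt : V).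
Variables (beta lambda : V -> R).

(* The value [lambda rt] is never used here or below. *)
Definition shift_fun (f : V -> R[i]) : V -> R[i] :=
  fun v => if v == rt then 0 else (lambda v)%:C%C * f (par E v).

Definition weighted_shift : operator R V :=
  [set fg | [/\ l2 beta fg.1, l2 beta fg.2 & fg.2 = shift_fun fg.1]].

Definition lambda_root v : R :=
  \prod_(j < depth E rt v) lambda (iter j (par E) v).

(* The exponent is [1 / 0 = 0] at [v = rt]; this only affects the infimum for
   [n = 0], hence not the limit. *)
Definition r2_path (W : set V) : \bar R :=
  limn (fun n : nat => ereal_inf
    [set ((Num.sqrt (beta v) * lambda_root v) `^ (depth E rt v)%:R^-1)%:E
       | v in [set v | W v /\ (n <= depth E rt v)%N]]).

Definition r2_plus : \bar R :=
  ereal_sup [set r | exists W F, tree_path E rt W F /\ r = r2_path W].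

End weighted_shift.

(* Main.v *)
(* Let [|z| < r_2^P] for a path [P] with vertices [w_0 = root, w_1, ...].  The
   function [f] supported on [P] with
     [f(w_n) = z ^ n / (beta_(w_n) * lambda_(root|w_n))]
   satisfies [beta_(w_(n+1)) lambda_(w_(n+1)) f(w_(n+1)) = z beta_(w_n) f(w_n)],
   that is, [S^* f = z f].  Its squared norm is
     [sum_n (|z| ^ n / (sqrt beta_(w_n) * lambda_(root|w_n))) ^ 2],
   which is eventually dominated by the geometric series of ratio
   [(|z| / r) ^ 2] for any [r] in [(|z|, r_2^P)]. *)
Require Import Defs.
From mathcomp Require Import all_boot all_order all_algebra finmap.
From mathcomp Require Import all_classical all_reals all_analysis complex ring.
From mathcomp.analysis.showcase Require summability.
Import Order.TTheory GRing.Theory Num.Theory.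
Import numFieldNormedType.Exports.
Local Open Scope classical_set_scope.
Local Open Scope ring_scope.

Set Implicit Arguments.
Unset Strict Implicit.

(** * Sums and square-summability along an injective sequence *)

Lemma partial_sum_reindex (I J : choiceType) (U : zmodType) (e : I -> J)
    (a : J -> U) (A : {fset J}) (B : {fset I}) :
  injective e -> (forall j, ~ range e j -> a j = 0) ->
  (forall i, (e i \in A) = (i \in B)) ->
  summability.partial_sum a A = summability.partial_sum (a \o e) B.
Proof.
move=> e_inj a0 AB; rewrite /summability.partial_sum.
rewrite -(big_seq_fsetE _ _ predT a) -(big_seq_fsetE _ _ predT (a \o e))/=.
have <- : \sum_(j <- (e @` B)%fset) a j = \sum_(i <- B) a (e i).
  by rewrite big_imfset//=; apply: in2W.
apply/esym/big_fset_incl.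
  by apply/fsubsetP => _ /imfsetP[i /= iB ->]; rewrite AB.
move=> j jA /imfsetP jB; apply: a0 => -[i _ eij]; apply: jB.
by exists i; rewrite //= -AB eij.
Qed.

(* No summability is assumed: both sides are limits of the same filter on [U],
   hence they agree even when the limit does not exist. *)
Lemma sum_reindex (I J : choiceType) (K : numDomainType) (U : normedModType K)
    (e : I -> J) (a : J -> U) :
  injective e -> (forall j, ~ range e j -> a j = 0) ->
  summability.sum a = summability.sum (a \o e).
Proof.
move=> e_inj a0; rewrite /summability.sum; congr (lim _).
have fin_pre (A : {fset J}) : finite_set (e @^-1` [set` A]).
  by apply: finite_preimage => //; apply: in2W.
rewrite predeqE => P; split=> -[A _ AP].
- exists (fset_set (e @^-1` [set` A])) => // B /= preAB.
  rewrite /= -(@partial_sum_reindex _ _ _ e a (A `|` e @` B)%fset)//.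
    by apply: AP; rewrite /= fsubsetUl.
  move=> i; rewrite inE (mem_imfset _ _ e_inj)/=.
  apply/orP/idP => [[eiA|//]|]; last by right.
  by apply: (fsubsetP preAB); rewrite in_fset_set// inE.
- exists (e @` A)%fset => // B /= AB.
  rewrite /= (@partial_sum_reindex _ _ _ e a B (fset_set (e @^-1` [set` B])))//.
    apply: AP => /=; apply/fsubsetP => i iA; rewrite in_fset_set// inE /=.
    by apply: (fsubsetP AB); rewrite (mem_imfset _ _ e_inj).
  by move=> i; rewrite in_fset_set//; apply/idP/idP; rewrite inE.
Qed.

(** The sum off the range of [w] vanishes, and on the range injectivity turns it into a series of
    nonnegative terms whose limit is real, hence finite. *)
Lemma l2_sequence (R : realType) (V : choiceType) (beta : V -> R)
    (w : nat -> V) (f : V -> R[i]) :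
  (forall v, 0 <= beta v) -> injective w ->
  (forall v, ~ range w v -> f v = 0) ->
  cvgn (series (fun n => Normc.normc (f (w n)) ^+ 2 * beta (w n))) ->
  l2 beta f.
Proof.
move=> beta0 w_inj f0 cv; rewrite /l2 /sqnorm_l2 /=.
have term0 v : (0 <= (Normc.normc (f v) ^+ 2 * beta v)%:E)%E.
  by rewrite lee_fin mulr_ge0// sqr_ge0.
rewrite (esumID (range w))// !setTI [X in (_ + X)%E]esum1 ?adde0; last first.
  by move=> v /f0 ->; rewrite Normc.normc0 expr0n mul0r.
rewrite esum_image; last by apply: in2W.
rewrite -nneseries_esumT//.
set u := fun n => Normc.normc (f (w n)) ^+ 2 * beta (w n) in cv *.
have -> : (fun n => \sum_(0 <= i < n) (u i)%:E)%E = EFin \o series u.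
  by apply/funext => n; rewrite /= sumEFin.
by rewrite EFin_lim// ltry.
Qed.

Lemma series_le_near_cvg (R : realType) (u v : R^nat) (N : nat) :
  (forall n, 0 <= u n) -> (forall n, 0 <= v n) ->
  (forall n, (N <= n)%N -> u n <= v n) ->
  cvgn (series v) -> cvgn (series u).
Proof.
(* Zeroing the terms below [N] makes the comparison hold at every index without affecting
   convergence. *)
move=> u0 v0 uv cv; pose u' n := if (N <= n)%N then u n else 0.
rewrite -(is_cvg_series_restrict N).
have -> : (fun n => \sum_(N <= k < n) u k) = (fun n => \sum_(N <= k < n) u' k).
  by apply/funext => n; apply: eq_big_nat => k /andP[Nk _]; rewrite /u' Nk.
rewrite is_cvg_series_restrict; apply: series_le_cvg cv => // n; rewrite /u'.
  by case: ifP.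
by case: ifP => // /uv.
Qed.

(** * Rays descending from the root *)

Lemma tree_path_ray (V : choiceType) (E : rel V) (rt : V) (W : set V)
    (F : rel V) :
  tree_path E rt W F ->
  exists w : nat -> V, w 0%N = rt /\ forall n, W (w n) /\ E (w n) (w n.+1).
Proof.
move=> [FE [FW _ _ _] Wrt child].
pose next u := xget u [set v | F u v].
have nextP u : W u -> F u (next u).
  by move=> /child[v [Fuv _]]; rewrite /next; case: xgetP => // /(_ v).
pose w n := iter n next rt.
have Ww n : W (w n) by elim: n => //= n /nextP /FW[].
by exists w; split=> // n; split=> //; apply/FE/nextP/Ww.
Qed.

Section ray.
Variables (V : choiceType) (E : rel V) (rt : V).
Hypothesis tree : rooted_directed_tree [set: V] E rt.

Lemma edge_neq_root u v : E u v -> v <> rt.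
Proof.
move=> Euv vrt; have [_ rootE] := tree.
have : parentless [set: V] E v by rewrite rootE.
by case=> _ /(_ u); rewrite Euv.
Qed.

Lemma par_edge u v : E u v -> par E v = u.
Proof.
move=> Euv; have [[_ _ _ uparent] _] := tree.
have : ~ parentless [set: V] E v by case=> _ /(_ u); rewrite Euv.
move=> /(uparent v I)[u' [_ uniq]]; rewrite /par.
by case: xgetP => [x _ /= /uniq <-|/(_ u)//]; apply: uniq.
Qed.

Variable w : nat -> V.
Hypotheses (w0 : w 0%N = rt) (wE : forall n, E (w n) (w n.+1)).

Lemma iter_par_ray n j : (j <= n)%N -> iter j (par E) (w n) = w (n - j)%N.
Proof.
elim: j => [|j IH] jn; first by rewrite subn0.
by rewrite iterS (IH (ltnW jn)) -(subnSK jn) (par_edge (wE _)).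
Qed.

(** Climbing [n] steps from [w n] reaches the root; any earlier stop is a vertex with a parent,
    hence not the root. *)
Lemma depth_ray n : depth E rt (w n) = n.
Proof.
have iter_neq j : (j < n)%N -> iter j (par E) (w n) <> rt.
  move=> jn; rewrite iter_par_ray; last exact: ltnW.
  by rewrite -(subnSK jn); apply: edge_neq_root (wE _).
have iter_n : iter n (par E) (w n) = rt by rewrite iter_par_ray// subnn.
rewrite /depth; case: xgetP => [k _ /= [kE kmin]|/(_ n)]; last by case.
by have [/iter_neq|/kmin|//] := ltngtP k n.
Qed.

Lemma ray_inj : injective w.
Proof. by move=> m n /(congr1 (depth E rt)); rewrite !depth_ray. Qed.

Lemma lambda_root_ray (R : realType) (lambda : V -> R) n :
  lambda_root E rt lambda (w n.+1)
  = lambda (w n.+1) * lambda_root E rt lambda (w n).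
Proof.
rewrite /lambda_root !depth_ray big_ord_recl; congr (_ * _).
by apply: eq_bigr => j _; rewrite lift0 iterSr (par_edge (wE n)).
Qed.

End ray.

(** The tail infima increase, so their limit is a supremum and some tail infimum exceeds [a]; that
    infimum is [r]. It bounds the values along [w] because each [w n] lies in [W]. *)
Lemma r2_path_lt (R : realType) (V : choiceType) (E : rel V) (rt : V)
    (beta lambda : V -> R) (W : set V) (w : nat -> V) (a : R) :
  (forall n, W (w n)) -> (forall n, depth E rt (w n) = n) ->
  (forall n, 0 <= lambda_root E rt lambda (w n)) -> 0 <= a ->
  (a%:E < r2_path E rt beta lambda W)%E ->
  exists2 r, a < r & exists N, forall n, (N < n)%N ->
    r ^+ n <= Num.sqrt (beta (w n)) * lambda_root E rt lambda (w n).
Proof.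
move=> Ww dw lam0 a0; rewrite /r2_path.
set u := (X in limn X).
pose s n := Num.sqrt (beta (w n)) * lambda_root E rt lambda (w n).
have u_nd : nondecreasing_seq u.
  move=> m n mn; apply: ereal_inf_le_tmp => _ [v [Wv nv] <-].
  by exists v => //; split=> //; apply: leq_trans nv.
rewrite (cvg_lim _ (ereal_nondecreasing_cvgn u_nd))//.
move=> /ereal_sup_gt[_ [N _ <-]] aN.
have uN n : (N <= n)%N -> (u N <= (s n `^ n%:R^-1)%:E)%E.
  by move=> Nn; apply: ereal_inf_lbound; exists (w n) => //; rewrite /= dw.
have uN_fin : u N \is a fin_num.
  rewrite fin_numE -ltNye -ltey (le_lt_trans _ aN) ?leNye//.
  by rewrite (le_lt_trans (uN N _))// ltry.
have ar : a < fine (u N) by rewrite -lte_fin fineK.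
(* The strict bound [N < n] forces [n] to be nonzero, so raising to the power [n] undoes the
   exponent [n^-1]. *)
exists (fine (u N)) => //; exists N => n Nn; have := uN n (ltnW Nn).
rewrite -(fineK uN_fin) lee_fin => rx.
have s0 : 0 <= s n by rewrite mulr_ge0// sqrtr_ge0.
have n0 : n%:R != 0 :> R by rewrite pnatr_eq0 -lt0n (leq_trans _ Nn).
rewrite -[leRHS]/(s n) -[leRHS]powRr1// -(mulVf n0) powRrM.
rewrite powR_mulrn ?powR_ge0//.
by rewrite lerXn2r// nnegrE ?powR_ge0// (le_trans a0)// ltW.
Qed.

(** * The eigenvector carried by a ray *)

Section eigenvector.
Variables (R : realType) (V : choiceType) (E : rel V) (rt : V).
Variables (beta lambda : V -> R).
Hypothesis tree : rooted_directed_tree [set: V] E rt.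
Hypotheses (beta_gt0 : forall v, 0 < beta v).
Hypotheses (lambda_gt0 : forall v, v != rt -> 0 < lambda v).
Variables (w : nat -> V) (z : R[i]).
Hypotheses (w0 : w 0%N = rt) (wE : forall n, E (w n) (w n.+1)).

Let depthw := depth_ray tree w0 wE.
Let lamr v := lambda_root E rt lambda v.

Lemma lambda_root_ray_gt0 n : 0 < lamr (w n).
Proof.
elim: n => [|n IH]; first by rewrite /lamr /lambda_root depthw big_ord0.
rewrite /lamr (lambda_root_ray tree w0 wE) mulr_gt0//.
by apply/lambda_gt0/eqP/(edge_neq_root tree (wE n)).
Qed.

(** A vertex of the ray occurs at the index equal to its depth, so the equality test decides
    membership in the ray. *)
Definition ray_eigenvector (v : V) : R[i] :=
  if v == w (depth E rt v) then
    z ^+ depth E rt v / (beta v * lamr v)%:C%C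
  else 0.

Let f := ray_eigenvector.

Lemma ray_eigenvectorE n : f (w n) = z ^+ n / (beta (w n) * lamr (w n))%:C%C.
Proof. by rewrite /f /ray_eigenvector depthw eqxx. Qed.

Lemma ray_eigenvector_out v : ~ range w v -> f v = 0.
Proof.
move=> vw; rewrite /f /ray_eigenvector; case: eqP => // vE; case: vw.
by exists (depth E rt v).
Qed.

(** At the root the numerator is [z ^+ 0 = 1], so the value is nonzero even for [z = 0]. *)
Lemma ray_eigenvector_neq0 : f <> (fun=> 0).
Proof.
move=> /(congr1 (@^~ (w 0%N))) /eqP; rewrite ray_eigenvectorE expr0 div1r.
rewrite invr_eq0 => /eqP/(congr1 (@complex.Re R))/eqP; rewrite /=.
by rewrite gt_eqF// mulr_gt0// lambda_root_ray_gt0.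
Qed.

Lemma ray_eigenvector_series (r : R) (N : nat) :
  Normc.normc z < r ->
  (forall n, (N < n)%N -> r ^+ n <= Num.sqrt (beta (w n)) * lamr (w n)) ->
  cvgn (series (fun n => Normc.normc (f (w n)) ^+ 2 * beta (w n))).
Proof.
move=> zr rN; set a := Normc.normc z in zr *.
have a0 : 0 <= a by rewrite /a; case: (z) => x y; apply: sqrtr_ge0.
have r0 : 0 < r by apply: le_lt_trans zr.
have q0 : 0 <= a / r by rewrite divr_ge0// ltW.
have q1 : `|(a / r) ^+ 2| < 1.
  by rewrite ger0_norm ?exprn_ge0// expr_lt1// ltr_pdivrMr// mul1r.
apply: (@series_le_near_cvg _ _ (geometric 1 ((a / r) ^+ 2)) N.+1);
  last exact: is_cvg_geometric_series.
- by move=> n; rewrite mulr_ge0 ?sqr_ge0// ltW.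
- by move=> n; rewrite /= mul1r exprn_ge0// exprn_ge0.
move=> n Nn; rewrite ray_eigenvectorE.
have b0 := beta_gt0 (w n); have l0 := lambda_root_ray_gt0 n.
have -> : Normc.normc (z ^+ n / (beta (w n) * lamr (w n))%:C%C)
    = a ^+ n / (beta (w n) * lamr (w n)).
  rewrite Normc.normcM Normc.normcV; congr (_ / _).
    elim: n {Nn b0 l0} => [|n IH]; first exact: Normc.normc1.
    by rewrite !exprS Normc.normcM IH.
  by rewrite /= expr0n addr0 sqrtr_sqr ger0_norm// mulr_ge0// ltW.
(* With [beta (w n) = s ^+ 2] the weighted square becomes the square of [a ^+ n / (s * lamr (w n))],
   to be compared with [(a / r) ^+ n]. *)
set s := Num.sqrt (beta (w n)).
have s0 : 0 < s by rewrite sqrtr_gt0.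
have bs : beta (w n) = s ^+ 2 by rewrite sqr_sqrtr// ltW.
have -> : (a ^+ n / (beta (w n) * lamr (w n))) ^+ 2 * beta (w n)
    = (a ^+ n / (s * lamr (w n))) ^+ 2.
  by rewrite bs; field; rewrite !gt_eqF.
rewrite /= mul1r -exprM mulnC exprM lerXn2r ?nnegrE//.
- by rewrite divr_ge0 ?exprn_ge0// mulr_ge0// ltW.
- by rewrite exprn_ge0.
rewrite expr_div_n ler_wpM2l ?exprn_ge0// lef_pV2 ?posrE ?exprn_gt0 ?mulr_gt0//.
exact: rN.
Qed.

(** The term at [w n.+1] on the left equals the term at [w n] on the right: both are [h (w n)] times
    the conjugate of [z ^+ n.+1], divided by [lamr (w n)]. *)
Lemma inner_shift_ray_eigenvector (h : V -> R[i]) :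
  inner_l2 beta (shift_fun E rt lambda h) f
  = inner_l2 beta h (fun v => z * f v).
Proof.
(* The left sum is indexed from [w 1], since the shifted function vanishes at the root. *)
rewrite /inner_l2 (@sum_reindex _ _ _ _ (w \o S)); first last.
- move=> v vw; have [->|/eqP vrt] := eqVneq v rt.
    by rewrite /shift_fun eqxx !mul0r.
  rewrite ray_eigenvector_out ?conjc0 ?mulr0 ?mul0r// => -[[|n] _ wn].
    by apply: vrt; rewrite -wn.
  by apply: vw; exists n.
- by move=> m n /(ray_inj tree w0 wE)[].
rewrite [RHS](sum_reindex (ray_inj tree w0 wE)); last first.
  by move=> v vw; rewrite ray_eigenvector_out// !(mulr0, conjc0, mul0r).
apply: (congr1 (@summability.sum nat _ R[i]^o)); apply/funext => n /=.
rewrite /shift_fun ifN; last first.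
  by apply/eqP/(edge_neq_root tree (wE n)).
rewrite (par_edge tree (wE n)) !ray_eigenvectorE.
have conj_divr (x : R[i]) (y : R) : (x / y%:C%C)^*%C = x^*%C / y%:C%C.
  by rewrite rmorphM fmorphV; congr (_ / _); exact: conjc_real.
rewrite mulrA !conj_divr -exprS /lamr (lambda_root_ray tree w0 wE).
rewrite !rmorphM.
have real_neq0 (x : R) : 0 < x -> x%:C%C != 0.
  by move=> x0; rewrite fmorph_eq0 gt_eqF.
have := lambda_root_ray_gt0 n; have lw : 0 < lambda (w n.+1).
  by apply/lambda_gt0/eqP/(edge_neq_root tree (wE n)).
move=> l0; field.
by rewrite !real_neq0.
Qed.

End eigenvector.

Unset Implicit Arguments.
Set Strict Implicit.

Theorem theorem23 (R : realType) (V : choiceType) (E : rel V) (rt : V)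
    (beta lambda : V -> R)
    (V_countably_infinite : ([set: V] #= [set: nat])%card)
    (T_tree : rooted_directed_tree [set: V] E rt)
    (T_leafless : leafless [set: V] E)
    (beta_gt0 : forall v, 0 < beta v)
    (lambda_gt0 : forall v, v != rt -> 0 < lambda v)
    (S_bounded : bounded_on_l2 beta (weighted_shift E rt beta lambda)) :
  [set z : R[i] | ((Normc.normc z)%:E < r2_plus E rt beta lambda)%E]
    `<=` point_spectrum (adjoint beta (weighted_shift E rt beta lambda)).
Proof.
(* Being below the supremum, [|z|] is below the value of a single path, from which a ray is
   extracted. *)
move=> z /= /ereal_sup_gt[_ [W [F [/tree_path_ray[w [w0 Ww] ->]]]]] zr.
have wE n : E (w n) (w n.+1) by have [] := Ww n.
have depthw := depth_ray T_tree w0 wE.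
have z0 : 0 <= Normc.normc z by case: (z) => x y; apply: sqrtr_ge0.
have lam0 n : 0 <= lambda_root E rt lambda (w n).
  by rewrite ltW// (lambda_root_ray_gt0 T_tree).
have [r zr' [N rN]] := r2_path_lt (fun n => (Ww n).1) depthw lam0 z0 zr.
have w_inj := ray_inj T_tree w0 wE.
have cv := ray_eigenvector_series T_tree beta_gt0 lambda_gt0 w0 wE zr' rN.
have f_out := @ray_eigenvector_out _ _ E rt beta lambda w z.
exists (ray_eigenvector E rt beta lambda w z); split.
  exact: ray_eigenvector_neq0.
split => /=.
- by apply: (@l2_sequence _ _ _ w) => // v; rewrite ltW.
- apply: (@l2_sequence _ _ _ w) => //=; [by move=> v; rewrite ltW| |].
    by move=> v /f_out ->; rewrite mulr0.
  (* The series for [z * f] is [|z| ^ 2] times the convergent series for [f]. *)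
  rewrite (_ : (fun n => _) = Normc.normc z ^+ 2 *: (fun n => Normc.normc
      (ray_eigenvector E rt beta lambda w z (w n)) ^+ 2 * beta (w n))).
    exact: is_cvg_seriesZ.
  by apply/funext => n; rewrite /= Normc.normcM exprMn -mulrA.
- by move=> h k [_ _ /= ->]; exact: inner_shift_ray_eigenvector.
Qed.
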